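(* Let $(L,[\cdot_\lambda\cdot],\alpha)$ be a Hom-Leibniz conformal algebra, let $\theta\in\mathbb C$, and let $R:L\to L$ be a Rota-Baxter operator of weight $\theta$ on it. Then $(L,\triangleleft_\lambda,\triangleright_\lambda,\vee_\lambda,\alpha)$ is a Hom-$NS$-Leibniz conformal algebra, where for $p,q\in L$ $$p\triangleleft_\lambda q=[R(p)_\lambda q],\qquad p\triangleright_\lambda q=[p_\lambda R(q)],\qquad p\vee_\lambda q=\theta[p_\lambda q].$$
   Context: All vector spaces are over $\mathbb C$; $V[\lambda]$ denotes polynomials in $\lambda$ with coefficients in $V$, and linear maps are extended coefficientwise to polynomials. A bilinear map $\circ_\lambda:L\otimes L\to L[\lambda]$ on a $\mathbb C[\partial]$-module is conformal sesqui-linear if $(\partial p)\circ_\lambda q=-\lambda\,p\circ_\lambda q$ and $p\circ_\lambda(\partial q)=(\partial+\lambda)(p\circ_\lambda q)$. A Hom-Leibniz conformal algebra $(L,[\cdot_\lambda\cdot],\alpha)$ is a $\mathbb C[\partial]$-module $L$ with a conformal sesqui-linear map $[\cdot_\lambda\cdot]:L\otimes L\to L[\lambda]$ and a linear map $\alpha:L\to L$ such that for all $p,q,r\in L$: $\alpha\partial=\partial\alpha$; $\alpha[p_\lambda q]=[\alpha(p)_\lambda\alpha(q)]$; $[\alpha(p)_\lambda[q_\mu r]]=[[p_\lambda q]_{\lambda+\mu}\alpha(r)]+[\alpha(q)_\mu[p_\lambda r]]$. A Rota-Baxter operator of weight $\theta$ on it is a $\mathbb C[\partial]$-linear map $R:L\to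 L$ with $\alpha R=R\alpha$ and $[R(p)_\lambda R(q)]=R([R(p)_\lambda q]+[p_\lambda R(q)]+\theta[p_\lambda q])$ for all $p,q\in L$. A Hom-$NS$-Leibniz conformal algebra $(L,\triangleleft_\lambda,\triangleright_\lambda,\vee_\lambda,\alpha)$ is a $\mathbb C[\partial]$-module $L$ with conformal sesqui-linear maps $\triangleleft_\lambda,\triangleright_\lambda,\vee_\lambda:L\otimes L\to L[\lambda]$ and a linear map $\alpha:L\to L$ with $\alpha\partial=\partial\alpha$, $\alpha(p\triangleleft_\lambda q)=\alpha(p)\triangleleft_\lambda\alpha(q)$, $\alpha(p\triangleright_\lambda q)=\alpha(p)\triangleright_\lambda\alpha(q)$, $\alpha(p\vee_\lambda q)=\alpha(p)\vee_\lambda\alpha(q)$ such that, writing $p*_\lambda q=p\triangleleft_\lambda q+p\triangleright_\lambda q+p\vee_\lambda q$, for all $p,q,r\in L$: $\alpha(p)\triangleright_\lambda(q*_\mu r)=(p\triangleright_\lambda q)\triangleright_{\lambda+\mu}\alpha(r)+\alpha(q)\triangleleft_\mu(p\triangleright_\lambda r)$; $\alpha(p)\triangleleft_\lambda(q\triangleright_\mu r)=(p\triangleleft_\lambda q)\triangleright_{\lambda+\mu}\alpha(r)+\alpha(q)\triangleright_\mu(p*_\lambda r)$; $\alpha(p)\triangleleft_\lambda(q\triangleleft_\mu r)=(p*_\lambda q)\triangleleft_{\lambda+\mu}\alpha(r)+\alpha(q)\triangleleft_\mu(p\triangleleft_\lambda r)$; $\alpha(p)\vee_\lambda(q*_\mu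 r)-\alpha(q)\vee_\mu(p*_\lambda r)-(p*_\lambda q)\vee_{\lambda+\mu}\alpha(r)+\alpha(p)\triangleleft_\lambda(q\vee_\mu r)-\alpha(q)\triangleleft_\mu(p\vee_\lambda r)-(p\vee_\lambda q)\triangleright_{\lambda+\mu}\alpha(r)=0$. *)

(* Defs.v *)
From HB Require Import structures.
From mathcomp Require Import all_boot all_order all_algebra.
From mathcomp Require Import finmap monalg.
From mathcomp Require Export reals complex.

Set Implicit Arguments.
Unset Strict Implicit.
Unset Printing Implicit Defensive.

Import GRing.Theory.
Local Open Scope ring_scope.

(* V[X], for a left A-module V, as a left A[X]-module: finitely supported
   coefficient families nat -> V, with u@_k the coefficient of X^k.
   The alias keeps this {poly A}-action apart from the scalings that monalg
   puts on {malg _[_]}. *)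
Definition polymod (V : zmodType) : Type := {malg V[nat]}.

HB.instance Definition _ (V : zmodType) := GRing.Zmodule.on (polymod V).

Section Polymod.
Context (A : nzRingType) (V : lmodType A).
Implicit Types (a b : {poly A}) (u v : polymod V).

Definition pscale a u : polymod V :=
  \sum_(i < size a) \sum_(k <- msupp u) << a`_i *: u@_k *g (i + k)%N >>.

Lemma pscaleE a u n :
  (pscale a u)@_n = \sum_(i < n.+1) a`_i *: u@_(n - i)%N.
Proof.
pose F i := \sum_(k <- msupp u) (a`_i *: u@_k) *+ (i + k == n)%N.
have FE i : F i = if (i < n.+1)%N then a`_i *: u@_(n - i)%N else 0.
  rewrite /F ltnS; case: leqP => [le_in | lt_ni]; last first.
    rewrite big1 // => k _; case: eqP => // e.
    by move: lt_ni; rewrite -e ltnNge leq_addr.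
  have E k : (i + k == n)%N = (k == n - i)%N.
    by rewrite -(eqn_add2l i k) subnKC.
  under eq_bigr do rewrite E.
  case: (msuppP u (n - i)%N) => [in_u | nin_u]; last first.
    rewrite scaler0 big1_seq // => k /= ku; case: eqP => // e.
    by move: nin_u; rewrite -e ku.
  rewrite (big_fsetD1 (n - i)%N) //= eqxx big1_seq ?addr0 // => k /=.
  by rewrite in_fsetD1 => /andP[/negbTE-> _].
transitivity (\sum_(i < size a) F i).
  rewrite /pscale raddf_sum; apply: eq_bigr => i _.
  by rewrite raddf_sum; apply: eq_bigr => k _; rewrite /= mcoeffU.
rewrite (big_ord_widen (maxn (size a) n.+1) F) ?leq_maxl //.
rewrite (big_ord_widen (maxn (size a) n.+1)
  (fun i => a`_i *: u@_(n - i)%N)) ?leq_maxr //.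
rewrite big_mkcond [RHS]big_mkcond; apply: eq_bigr => i _ /=.
rewrite FE; case: ltnP => // le_ai.
by rewrite nth_default // scale0r if_same.
Qed.

Fact pscaleA a b u : pscale a (pscale b u) = pscale (a * b) u.
Proof.
apply/malgP => n; rewrite !pscaleE.
pose c j k := (a`_j * b`_(n - j - k)) *: u@_k.
have rev w d m : (pscale d w)@_m = \sum_(k < m.+1) d`_(m - k) *: w@_(k : nat).
  rewrite pscaleE (reindex_inj rev_ord_inj) /=.
  by apply: eq_bigr => k _; rewrite subSS subKn // -ltnS.
transitivity (\sum_(j < n.+1) \sum_(k < n.+1 | (k <= n - j)%N) c j k).
  apply: eq_bigr => /= j _; rewrite rev scaler_sumr.
  rewrite (big_ord_narrow_leq (leq_subr _ _)).
  by apply: eq_bigr => k _; rewrite scalerA.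
rewrite (exchange_big_dep predT) //= (reindex_inj rev_ord_inj) /=.
apply: eq_bigr => k _; rewrite subSS.
transitivity (\sum_(j < n.+1 | (j <= k)%N) c j (n - k)%N).
  apply: eq_bigl => j; have := ltn_ord j; have := ltn_ord k; rewrite !ltnS.
  by move=> kn jn; rewrite leq_sub2lE.
rewrite (big_ord_narrow_leq (ltn_ord k : (k <= n)%N)) coefM scaler_suml.
apply: eq_bigr => j _; rewrite /c /= subnAC subKn //.
exact: (ltn_ord k : (k <= n)%N).
Qed.

Fact pscale1 : left_id 1 pscale.
Proof.
move=> u; apply/malgP => n; rewrite pscaleE big_ord_recl big1 /=.
  by rewrite coef1 scale1r subn0 addr0.
by move=> i _; rewrite coef1 scale0r.
Qed.

Fact pscaleDr : right_distributive pscale +%R.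
Proof.
move=> a u v; apply/malgP => n; rewrite mcoeffD !pscaleE -big_split /=.
by apply: eq_bigr => i _; rewrite mcoeffD scalerDr.
Qed.

Fact pscaleDl u : {morph pscale^~ u : a b / a + b}.
Proof.
move=> a b; apply/malgP => n; rewrite mcoeffD !pscaleE -big_split /=.
by apply: eq_bigr => i _; rewrite coefD scalerDl.
Qed.

HB.instance Definition _ := GRing.Zmodule_isLmodule.Build {poly A} (polymod V)
  pscaleA pscale1 pscaleDr pscaleDl.

Definition constp (v : V) : polymod V := << v *g 0%N >>.

(* coefficientwise extension of f to polynomials *)
Definition map_polymod (f : V -> V) u : polymod V :=
  \sum_(k <- msupp u) << f u@_k *g k >>.

End Polymod.

Section HomLeibnizConformal.
Context (K : fieldType) (L : lmodType {poly K}).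

(* L is a K[d]-module, so L[lambda] is a K[d][lambda]-module and
   L[lambda][mu] a K[d][lambda][mu]-module.  A scalar c of K acts on L as
   c%:P and on L[lambda] as c%:P%:P; d acts as 'X and as 'X%:P. *)
Notation L1 := (polymod L).
Notation L2 := (polymod (polymod L)).

Definition Klinear (f : L -> L) : Prop :=
  forall (c : K) (p q : L), f (c%:P *: p + q) = c%:P *: f p + f q.

Record conformal_sesquilinear (o : L -> L -> L1) : Prop :=
  ConformalSesquilinear {
    sesq_linearl : forall (c : K) (p p' q : L),
      o (c%:P *: p + p') q = c%:P%:P *: o p q + o p' q;
    sesq_linearr : forall (c : K) (p q q' : L),
      o p (c%:P *: q + q') = c%:P%:P *: o p q + o p q';
    sesq_dl : forall p q : L, o ('X *: p) q = - ('X *: o p q);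
    sesq_dr : forall p q : L, o p ('X *: q) = ('X%:P + 'X) *: o p q
  }.

Definition lam : {poly {poly {poly K}}} := 'X%:P.
Definition mu : {poly {poly {poly K}}} := 'X.

Definition const2 (p : L) : L2 := constp (constp p).

(* the K[lambda, mu]-linear extension of f to L[lambda][mu] *)
Definition ext2 (f : L -> L2) (u : L2) : L2 :=
  \sum_(j <- msupp u) \sum_(i <- msupp u@_j)
    (lam ^+ i * mu ^+ j) *: f u@_j@_i.

Definition subst2 (s : {poly {poly {poly K}}}) (w : L1) : L2 :=
  \sum_(k <- msupp w) s ^+ k *: const2 w@_k.

(* u o_s v in L[lambda][mu], for s one of lambda, mu, lambda + mu: the product
   o_s on constants, extended K[lambda, mu]-bilinearly *)
Definition prod_at (o : L -> L -> L1) (s : {poly {poly {poly K}}}) (u v : L2) :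
    L2 :=
  ext2 (fun p => ext2 (fun q => subst2 s (o p q)) v) u.

Record hom_Leibniz_conformal (br : L -> L -> L1) (alpha : L -> L) : Prop :=
  HomLeibnizConformal {
    hl_sesq : conformal_sesquilinear br;
    hl_linear : Klinear alpha;
    hl_d : forall p : L, alpha ('X *: p) = 'X *: alpha p;
    hl_mult : forall p q : L, map_polymod alpha (br p q) = br (alpha p) (alpha q);
    hl_jacobi : forall p q r : L,
      prod_at br lam (const2 (alpha p)) (prod_at br mu (const2 q) (const2 r)) =
      prod_at br (lam + mu)
        (prod_at br lam (const2 p) (const2 q)) (const2 (alpha r)) +
      prod_at br mu (const2 (alpha q)) (prod_at br lam (const2 p) (const2 r))
  }.

Record Rota_Baxter (theta : K) (br : L -> L -> L1) (alpha : L -> L)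
    (R : {linear L -> L}) : Prop := RotaBaxter {
  rb_alpha : forall p : L, alpha (R p) = R (alpha p);
  rb_eq : forall p q : L,
    br (R p) (R q) =
    map_polymod R (br (R p) q + br p (R q) + theta%:P%:P *: br p q)
}.

Section NS.
Context (tl tr vee : L -> L -> L1) (alpha : L -> L).

Definition ns_star (p q : L) : L1 := tl p q + tr p q + vee p q.

Local Notation "p %:K" := (const2 p) (at level 2, format "p %:K").
Local Notation "u '<|' [ s ] v" := (prod_at tl s u v)
  (at level 40, s at level 200, v at level 39).
Local Notation "u '|>' [ s ] v" := (prod_at tr s u v)
  (at level 40, s at level 200, v at level 39).
Local Notation "u '\v' [ s ] v" := (prod_at vee s u v)
  (at level 40, s at level 200, v at level 39).
Local Notation "u '**' [ s ] v" := (prod_at ns_star s u v)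
  (at level 40, s at level 200, v at level 39).

Record hom_NS_Leibniz_conformal : Prop := HomNSLeibnizConformal {
  ns_sesq_tl : conformal_sesquilinear tl;
  ns_sesq_tr : conformal_sesquilinear tr;
  ns_sesq_vee : conformal_sesquilinear vee;
  ns_linear : Klinear alpha;
  ns_d : forall p : L, alpha ('X *: p) = 'X *: alpha p;
  ns_mult_tl : forall p q : L, map_polymod alpha (tl p q) = tl (alpha p) (alpha q);
  ns_mult_tr : forall p q : L, map_polymod alpha (tr p q) = tr (alpha p) (alpha q);
  ns_mult_vee : forall p q : L, map_polymod alpha (vee p q) = vee (alpha p) (alpha q);
  ns_1 : forall p q r : L,
    (alpha p)%:K |>[lam] (q%:K **[mu] r%:K) =
    (p%:K |>[lam] q%:K) |>[lam + mu] (alpha r)%:K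
    + (alpha q)%:K <|[mu] (p%:K |>[lam] r%:K);
  ns_2 : forall p q r : L,
    (alpha p)%:K <|[lam] (q%:K |>[mu] r%:K) =
    (p%:K <|[lam] q%:K) |>[lam + mu] (alpha r)%:K
    + (alpha q)%:K |>[mu] (p%:K **[lam] r%:K);
  ns_3 : forall p q r : L,
    (alpha p)%:K <|[lam] (q%:K <|[mu] r%:K) =
    (p%:K **[lam] q%:K) <|[lam + mu] (alpha r)%:K
    + (alpha q)%:K <|[mu] (p%:K <|[lam] r%:K);
  ns_4 : forall p q r : L,
    (alpha p)%:K \v[lam] (q%:K **[mu] r%:K)
    - (alpha q)%:K \v[mu] (p%:K **[lam] r%:K)
    - (p%:K **[lam] q%:K) \v[lam + mu] (alpha r)%:K
    + (alpha p)%:K <|[lam] (q%:K \v[mu] r%:K)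
    - (alpha q)%:K <|[mu] (p%:K \v[lam] r%:K)
    - (p%:K \v[lam] q%:K) |>[lam + mu] (alpha r)%:K = 0
}.

End NS.
End HomLeibnizConformal.

(* Main.v *)
Require Import Defs.
From mathcomp Require Import all_boot all_algebra.
From mathcomp Require Import finmap monalg.

Local Open Scope ring_scope.

Set Implicit Arguments.
Unset Strict Implicit.
Unset Printing Implicit Defensive.

Import GRing.Theory.

(** Each identity to be proved is the Jacobi identity with [R] put in front of
    some of the arguments.  Write [p * q] for the sum of the three new products;
    the Rota-Baxter identity says [R (p * q) = [R p, R q]].  Hence the first
    three identities are the Jacobi identity at [(p, R q, R r)],
    [(R p, q, R r)] and [(R p, R q, r)], because [R] commutes with [alpha] and
    each occurrence of [*] in them sits under an [R].  The fourth one is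
    [theta] times the sum of the Jacobi identities at [(p, R q, r)],
    [(p, q, R r)] and [(R p, q, r)] and of [theta] times the one at [(p, q, r)].

    What remains is to make sense of [[a _s w]] for [w = \sum_k t ^+ k w_k] a
    polynomial in another variable [t], so that [R] and [theta] can be moved
    through it.  All the iterated products have the form
    [\sum_k t ^+ k *: f w_k], written [eval_ext f t w], where [f] maps [z] to
    [[a _s z]] or [[z _s a]] ([prod_at_right], [prod_at_left]).  The extension
    of [R] to polynomials is absorbed by [f] ([eval_ext_map]), and scalars of
    the ground field come out ([eval_extZ], [eval_subst2_scale]).  The
    reduction to this form rests on the fact that the bilinear extension
    commutes with multiplication by [lambda] and [mu] ([ext2_lam],
    [ext2_mu]). *)

(** * Sums over the coefficients of a polynomial *)

Lemma morphD0 (V W : zmodType) (f : V -> W) :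
  {morph f : x y / x + y} -> f 0 = 0.
Proof. by move=> fD; apply: (addrI (f 0)); rewrite -fD !addr0. Qed.

Section Msum.
Context (V W : zmodType).
Implicit Types (h : nat -> V -> W) (u v : polymod V).

(** The common form of the coefficientwise extension of a map, of substitution
    for the variable and of both layers of [ext2]. *)
Definition msum h u : W := \sum_(k <- msupp u) h k u@_k.

Definition msum_additive h := forall k, {morph h k : x y / x + y}.

(** Two sums over different supports can only be compared over a common index
    set. *)
Lemma msumEw h u (D : {fset nat}) : msum_additive h ->
  (msupp u `<=` D)%fset -> msum h u = \sum_(k <- D) h k u@_k.
Proof.
move=> hD sub; apply: big_fset_incl => // k _ /mcoeff_outdom ->.
exact: (morphD0 (hD k)).
Qed.

Lemma msumD h : msum_additive h -> {morph msum h : u v / u + v}.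
Proof.
move=> hD u v; pose D := (msupp u `|` msupp v `|` msupp (u + v))%fset.
rewrite !(@msumEw h _ D) ?fsubsetUr //.
- by rewrite -big_split; apply: eq_bigr => k _; rewrite mcoeffD hD.
- by rewrite /D -fsetUA fsetUCA fsubsetUl.
- by rewrite /D -fsetUA fsubsetUl.
Qed.

Lemma msumU h k x : msum_additive h -> msum h << x *g k >> = h k x.
Proof.
move=> hD; rewrite (@msumEw h _ [fset k]%fset) ?msuppU_le //.
by rewrite big_seq_fset1 mcoeffUU.
Qed.

(** Polynomials are sums of monomials; most of the identities between
    extensions below are checked on monomials through this lemma. *)
Lemma polymod_ext (f g : polymod V -> W) :
    {morph f : u v / u + v} -> {morph g : u v / u + v} ->
  (forall k x, f << x *g k >> = g << x *g k >>) -> f =1 g.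
Proof.
move=> fD gD fg u; rewrite (monalgE u).
rewrite (big_morph f fD (morphD0 fD)) (big_morph g gD (morphD0 gD)).
exact: eq_bigr.
Qed.

End Msum.

(** * Action of constants and of the variable on monomials *)

Section Scaling.
Context (A : nzRingType) (V : lmodType A).
Implicit Types (c : A) (u : polymod V).

Lemma mcoeffCZ c u k : (c%:P *: u : polymod V)@_k = c *: u@_k.
Proof.
rewrite [LHS](pscaleE c%:P u) big_ord_recl big1 /= => [|i _].
  by rewrite addr0 coefC subn0.
by rewrite coefC scale0r.
Qed.

Lemma scaleCU c (x : V) k :
  c%:P *: (<< x *g k >> : polymod V) = << c *: x *g k >> :> polymod V.
Proof.
apply/malgP => n; rewrite mcoeffCZ !mcoeffU.
by case: eqP; rewrite ?scaler0.
Qed.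

Lemma scaleXU (x : V) k :
  'X *: (<< x *g k >> : polymod V) = << x *g k.+1 >> :> polymod V.
Proof.
apply/malgP => -[|n]; rewrite [LHS](pscaleE 'X) mcoeffU.
  by rewrite big_ord1 coefX scale0r.
rewrite 2!big_ord_recl big1 /= => [|i _]; last by rewrite coefX scale0r.
by rewrite !coefX /= scale0r scale1r add0r addr0 subn1 mcoeffU eqSS.
Qed.

Lemma msumZ (B : nzRingType) (W : lmodType B) (h : nat -> V -> W) c (b : B) :
    msum_additive h -> (forall k x, h k (c *: x) = b *: h k x) ->
  forall u, msum h (c%:P *: u) = b *: msum h u.
Proof.
move=> hD hZ; apply: polymod_ext => [u v|u v|k x].
- by rewrite scalerDr msumD.
- by rewrite msumD // scalerDr.
- by rewrite scaleCU !msumU.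
Qed.

Lemma constpD : {morph @constp A V : x y / x + y}.
Proof. by move=> x y; rewrite /constp monalgUD. Qed.

Lemma constpZ c (x : V) : constp (c *: x) = c%:P *: constp x.
Proof. by rewrite [RHS]scaleCU. Qed.

Lemma map_polymodE (f : V -> V) u :
  map_polymod f u = msum (fun k x => << f x *g k >>) u.
Proof. by []. Qed.

End Scaling.

(** * Extending linear maps to polynomials in one and two variables *)

Section HomLeibniz.
Context (K : fieldType) (L : lmodType {poly K}).
Local Notation L1 := (polymod L).
Local Notation L2 := (polymod (polymod L)).
Implicit Types (f : L -> L2) (s t : {poly {poly {poly K}}}) (w : L1).
Implicit Types (o : L -> L -> L1).
Local Notation lam := (lam K).
Local Notation mu := (mu K).

(** Linearity over the ground field only: [p |-> [p _lambda q]] is not linear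
    over the polynomials in the derivation. *)
Definition Klinear2 f :=
  forall (c : K) p q, f (c%:P *: p + q) = c%:P%:P%:P *: f p + f q.

Lemma Klinear2D f : Klinear2 f -> {morph f : p q / p + q}.
Proof. by move=> fK p q; have := fK 1 p q; rewrite !polyC1 !scale1r. Qed.

Lemma Klinear2Z f (c : K) p : Klinear2 f -> f (c%:P *: p) = c%:P%:P%:P *: f p.
Proof.
move=> fK; rewrite -[_ *: p]addr0 fK.
by rewrite (morphD0 (Klinear2D fK)) addr0.
Qed.

(** [f] applied to the coefficients of [w], with the variable of [w] replaced by
    [s]; [subst2] is the case where [f] is the inclusion of constants. *)
Definition eval_ext f s w : L2 := msum (fun k v => s ^+ k *: f v) w.

Lemma eval_ext_additive f s :
  Klinear2 f -> msum_additive (fun k v => s ^+ k *: f v).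
Proof. by move=> fK k x y; rewrite (Klinear2D fK) scalerDr. Qed.

Lemma eval_extD f s : Klinear2 f -> {morph eval_ext f s : w w' / w + w'}.
Proof. by move=> fK; apply/msumD/eval_ext_additive. Qed.

Lemma eval_extZ f s (c : K) w : Klinear2 f ->
  eval_ext f s (c%:P%:P *: w) = c%:P%:P%:P *: eval_ext f s w.
Proof.
move=> fK; apply: msumZ; first exact: eval_ext_additive.
by move=> k x; rewrite (Klinear2Z _ _ fK) !scalerA mulrC.
Qed.

Lemma eval_ext_scale f s (c : {poly {poly {poly K}}}) w :
  eval_ext (fun v => c *: f v) s w = c *: eval_ext f s w.
Proof.
rewrite /eval_ext /msum scaler_sumr; apply: eq_bigr => k _.
by rewrite !scalerA mulrC.
Qed.

Lemma eq_eval_ext f g s w : f =1 g -> eval_ext f s w = eval_ext g s w.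
Proof. by move=> fg; apply: eq_bigr => k _; rewrite fg. Qed.

(** This is how the Rota-Baxter identity enters iterated products: an [R] on the
    inner argument of [f] becomes an [R] on the whole polynomial [w]. *)
Lemma eval_ext_map f s (g : {linear L -> L}) w : Klinear2 f ->
  eval_ext f s (map_polymod g w) = eval_ext (fun v => f (g v)) s w.
Proof.
move=> fK; have hD := eval_ext_additive s fK.
have gD : msum_additive (fun k x => << g x *g k >> : L1).
  by move=> k x y; rewrite linearD monalgUD.
have fgD : msum_additive (fun k x => s ^+ k *: f (g x)).
  by move=> k x y; rewrite linearD hD.
move: w; apply: polymod_ext => [u v|u v|k x].
- by rewrite !map_polymodE msumD // eval_extD.
- exact: msumD.
- rewrite map_polymodE (msumU k x gD).
  exact: etrans (msumU k (g x) hD) (esym (msumU k x fgD)).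
Qed.

Lemma const2_Klinear2 : Klinear2 (@const2 K L).
Proof. by move=> c p q; rewrite /const2 !constpD !constpZ. Qed.

Lemma subst2E s w : subst2 s w = eval_ext (@const2 K L) s w.
Proof. by []. Qed.

Lemma ext2E f (u : L2) : ext2 f u =
  msum (fun j x => msum (fun i v => (lam ^+ i * mu ^+ j) *: f v) x) u.
Proof. by []. Qed.

Section Ext2.
Variables (f : L -> L2) (fK : Klinear2 f).

Let in_additive j : msum_additive (fun i v => (lam ^+ i * mu ^+ j) *: f v).
Proof. by move=> i x y; rewrite (Klinear2D fK) scalerDr. Qed.

Let out_additive : msum_additive
  (fun j x => msum (fun i v => (lam ^+ i * mu ^+ j) *: f v) x).
Proof. by move=> j x y; rewrite msumD. Qed.

Lemma ext2D : {morph ext2 f : u v / u + v}.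
Proof. by move=> u v; rewrite !ext2E msumD. Qed.

Lemma ext2U (x : L) i j :
  ext2 f << << x *g i >> *g j >> = (lam ^+ i * mu ^+ j) *: f x.
Proof. by rewrite ext2E !msumU. Qed.

Lemma ext2_const2 x : ext2 f (const2 x) = f x.
Proof. by rewrite ext2U !expr0 mulr1 scale1r. Qed.

Lemma ext2_ext (g h : L2 -> L2) :
    {morph g : u v / u + v} -> {morph h : u v / u + v} ->
    (forall x i j, g << << x *g i >> *g j >> = h << << x *g i >> *g j >>) ->
  g =1 h.
Proof.
move=> gD hD gh; apply: polymod_ext => // j.
apply: (@polymod_ext _ _ (fun w => g << w *g j >>) (fun w => h << w *g j >>)).
- by move=> u v; rewrite monalgUD gD.
- by move=> u v; rewrite monalgUD hD.
- by move=> i x; apply: gh.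
Qed.

(** Multiplication by [lam] shifts the inner exponent; the weight of a monomial
    in [ext2] gains the same factor. *)
Lemma ext2_lam u : ext2 f (lam *: u) = lam *: ext2 f u.
Proof.
move: u; apply: ext2_ext => [u v|u v|x i j];
  rewrite ?scalerDr ?ext2D ?scalerDr //.
by rewrite scaleCU scaleXU !ext2U scalerA mulrA exprS.
Qed.

Lemma ext2_mu u : ext2 f (mu *: u) = mu *: ext2 f u.
Proof.
move: u; apply: ext2_ext => [u v|u v|x i j];
  rewrite ?scalerDr ?ext2D ?scalerDr //.
by rewrite scaleXU !ext2U scalerA mulrCA exprS.
Qed.

(** Since [subst2 t w] is the sum of the [t ^+ k *: const2 w@_k], commuting with
    [t] and the value on constants determine [ext2 f] there. *)
Lemma ext2_subst2 t w : (forall u, ext2 f (t *: u) = t *: ext2 f u) ->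
  ext2 f (subst2 t w) = eval_ext f t w.
Proof.
move=> ft; move: w; apply: polymod_ext => [u v|u v|k x].
- by rewrite !subst2E (eval_extD _ const2_Klinear2) ext2D.
- exact: eval_extD.
have constD := eval_ext_additive t const2_Klinear2.
have -> : subst2 t << x *g k >> = t ^+ k *: const2 x.
  exact: msumU k x constD.
have -> : eval_ext f t << x *g k >> = t ^+ k *: f x.
  exact: msumU k x (eval_ext_additive t fK).
elim: k => [|k IHk]; first by rewrite expr0 !scale1r ext2_const2.
by rewrite exprS -!scalerA ft IHk.
Qed.

End Ext2.

(** * Iterated conformal products *)

Lemma subst2_linl o s q :
  conformal_sesquilinear o -> Klinear2 (fun p => subst2 s (o p q)).
Proof.
case=> oKl _ _ _ c p p'; rewrite oKl !subst2E (eval_extD _ const2_Klinear2).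
by rewrite (eval_extZ _ _ _ const2_Klinear2).
Qed.

Lemma subst2_linr o s p :
  conformal_sesquilinear o -> Klinear2 (fun q => subst2 s (o p q)).
Proof.
case=> _ oKr _ _ c q q'; rewrite oKr !subst2E (eval_extD _ const2_Klinear2).
by rewrite (eval_extZ _ _ _ const2_Klinear2).
Qed.

Lemma eq_ext2 f g u : f =1 g -> ext2 f u = ext2 g u.
Proof. by move=> fg; do 2!apply: eq_bigr => ? _; rewrite fg. Qed.

Lemma eval_subst2_scale (g : L -> L1) s t (c : K) w :
  eval_ext (fun z => subst2 s (c%:P%:P *: g z)) t w =
  c%:P%:P%:P *: eval_ext (fun z => subst2 s (g z)) t w.
Proof.
rewrite -eval_ext_scale; apply: eq_eval_ext => z.
exact: eval_extZ const2_Klinear2.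
Qed.

Lemma prod_at_const o s p q : conformal_sesquilinear o ->
  prod_at o s (const2 p) (const2 q) = subst2 s (o p q).
Proof.
move=> oS; have E a : ext2 (fun q => subst2 s (o a q)) (const2 q) =
    subst2 s (o a q) by rewrite ext2_const2 //; apply: subst2_linr.
by rewrite /prod_at (eq_ext2 _ E) ext2_const2 //; apply: subst2_linl.
Qed.

(** Holds for the variables [lam] and [mu], but in general not for scalars that
    involve the derivation, such as ['X%:P%:P]. *)
Definition ext2_scalar t :=
  forall f u, Klinear2 f -> ext2 f (t *: u) = t *: ext2 f u.

Lemma ext2_scalar_lam : ext2_scalar lam.
Proof. by move=> f u fK; apply: ext2_lam. Qed.

Lemma ext2_scalar_mu : ext2_scalar mu.
Proof. by move=> f u fK; apply: ext2_mu. Qed.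

(** The left factor is a constant, so only the right one is expanded; that
    expansion is again linear in the left argument, which is what removes the
    outer [ext2]. *)
Lemma prod_at_right o o' s t p q r : ext2_scalar t ->
    conformal_sesquilinear o -> conformal_sesquilinear o' ->
  prod_at o s (const2 p) (prod_at o' t (const2 q) (const2 r)) =
  eval_ext (fun z => subst2 s (o p z)) t (o' q r).
Proof.
move=> tK oS o'S; rewrite (prod_at_const _ _ _ o'S) /prod_at.
have E a : ext2 (fun q => subst2 s (o a q)) (subst2 t (o' q r)) =
    eval_ext (fun z => subst2 s (o a z)) t (o' q r).
  have aK := subst2_linr s a oS.
  by rewrite ext2_subst2 // => u; apply: tK.
rewrite (eq_ext2 _ E) ext2_const2 // => c a b.
rewrite -eval_ext_scale /eval_ext /msum -big_split /=.
apply: eq_bigr => k _.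
by rewrite -scalerDr (subst2_linl s _ oS).
Qed.

Lemma prod_at_left o o' s t p q r : ext2_scalar t ->
    conformal_sesquilinear o -> conformal_sesquilinear o' ->
  prod_at o s (prod_at o' t (const2 p) (const2 q)) (const2 r) =
  eval_ext (fun z => subst2 s (o z r)) t (o' p q).
Proof.
move=> tK oS o'S; rewrite (prod_at_const _ _ _ o'S) /prod_at.
have E a : ext2 (fun q => subst2 s (o a q)) (const2 r) = subst2 s (o a r).
  by rewrite ext2_const2 //; apply: subst2_linr.
have rK := subst2_linl s r oS.
by rewrite (eq_ext2 _ E) ext2_subst2 // => u; apply: tK.
Qed.

(** * Operations on conformal sesqui-linear maps *)

Lemma sesq_compl o (R : {linear L -> L}) :
  conformal_sesquilinear o -> conformal_sesquilinear (fun p q => o (R p) q).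
Proof.
by case=> ol or odl odr; split=> *;
  rewrite ?(linearP R, linearZ_LR R) ?(ol, or, odl, odr).
Qed.

Lemma sesq_compr o (R : {linear L -> L}) :
  conformal_sesquilinear o -> conformal_sesquilinear (fun p q => o p (R q)).
Proof.
by case=> ol or odl odr; split=> *;
  rewrite ?(linearP R, linearZ_LR R) ?(ol, or, odl, odr).
Qed.

Lemma sesq_scale o (c : K) : conformal_sesquilinear o ->
  conformal_sesquilinear (fun p q => c%:P%:P *: o p q).
Proof.
case=> ol or odl odr; split=> *.
- by rewrite ol scalerDr !scalerA mulrC.
- by rewrite or scalerDr !scalerA mulrC.
- by rewrite odl scalerN !scalerA mulrC.
- by rewrite odr !scalerA mulrC.
Qed.

Lemma sesq_add o o' : conformal_sesquilinear o -> conformal_sesquilinear o' ->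
  conformal_sesquilinear (fun p q => o p q + o' p q).
Proof.
case=> ol or odl odr [ol' or' odl' odr']; split=> *.
- by rewrite ol ol' scalerDr addrACA.
- by rewrite or or' scalerDr addrACA.
- by rewrite odl odl' scalerDr opprD.
- by rewrite odr odr' scalerDr.
Qed.

Lemma map_polymod_scale (alpha : L -> L) (c : K) w : Klinear alpha ->
  map_polymod alpha (c%:P%:P *: w) = c%:P%:P *: map_polymod alpha w.
Proof.
move=> aK; have aD : {morph alpha : x y / x + y}.
  by move=> x y; have := aK 1 x y; rewrite !polyC1 !scale1r.
have aZ x : alpha (c%:P *: x) = c%:P *: alpha x.
  by rewrite -[c%:P *: x]addr0 aK (morphD0 aD) addr0.
rewrite !map_polymodE; apply: msumZ => [k x y|k x].
  by rewrite aD monalgUD.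
by rewrite aZ scaleCU.
Qed.

(** The additive skeleton of the fourth identity: [x_i = z_i + y_i] are four
    Jacobi identities and [t1], ..., [t6] the terms of the identity, the first
    three of which contain [*] and so split in three.  Each [y_i] and each [z_i]
    then occurs once with either sign. *)
Lemma NS_cancel (V : zmodType)
    (t1 t2 t3 t4 t5 t6 x1 x2 x3 x4 y1 y2 y3 y4 z1 z2 z3 z4 : V) :
    t1 = x1 + x2 + x3 -> t2 = y4 + y2 + y3 -> t3 = z4 + z1 + z3 ->
    t4 = x4 -> t5 = y1 -> t6 = z2 ->
    x1 = z1 + y1 -> x2 = z2 + y2 -> x3 = z3 + y3 -> x4 = z4 + y4 ->
  t1 - t2 - t3 + t4 - t5 - t6 = 0.
Proof.
do 10!move=> ->; rewrite !opprD !addrA.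
set P := (X in X = 0).
have -> : P = (z1 - z1) + (y1 - y1) + (z2 - z2) + (y2 - y2) + (z3 - z3)
   + (y3 - y3) + (z4 - z4) + (y4 - y4).
  rewrite !addrA.
  (* the right-hand side lists z1, - z1, y1, - y1, z2, ...; the numbers are the
     places there of the successive terms of P *)
  by rewrite {}/P [RHS](ACl (1*3*5*7*9*11*16*8*12*14*2*10*13*15*4*6)).
by rewrite !subrr !addr0.
Qed.

(** * The Rota-Baxter construction *)

Section RotaBaxter.
Variables (br : L -> L -> L1) (alpha : L -> L).
Variables (theta : K) (R : {linear L -> L}).
Hypotheses (brH : hom_Leibniz_conformal br alpha).
Hypothesis (RB : Rota_Baxter theta br alpha R).

Let tl p q := br (R p) q.
Let tr p q := br p (R q).
Let vee p q := theta%:P%:P *: br p q.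
Local Notation Theta := (theta%:P%:P%:P).

Lemma hl_jacobi_eval p q r :
  eval_ext (fun z => subst2 lam (br (alpha p) z)) mu (br q r) =
  eval_ext (fun z => subst2 (lam + mu) (br z (alpha r))) lam (br p q) +
  eval_ext (fun z => subst2 mu (br (alpha q) z)) lam (br p r).
Proof.
have S := hl_sesq brH; have [KL KM] := (ext2_scalar_lam, ext2_scalar_mu).
by have := hl_jacobi brH p q r; rewrite !prod_at_right // prod_at_left.
Qed.

(** The left-hand side is [f] extended to [R (p * q)], to which the Rota-Baxter
    identity applies. *)
Lemma eval_ext_star f t p q : Klinear2 f ->
  eval_ext (fun z => f (R z)) t (ns_star tl tr vee p q) =
  eval_ext f t (br (R p) (R q)).
Proof. by move=> fK; rewrite (rb_eq RB) eval_ext_map. Qed.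

Lemma eval_ext_starE f t p q : Klinear2 f ->
  eval_ext f t (ns_star tl tr vee p q) =
  eval_ext f t (br (R p) q) + eval_ext f t (br p (R q)) +
  Theta *: eval_ext f t (br p q).
Proof.
move=> fK; rewrite /ns_star (eval_extD _ fK) (eval_extD _ fK).
by rewrite (eval_extZ _ _ _ fK).
Qed.

Lemma vee_star_r s t a p q :
  eval_ext (fun z => subst2 s (vee a z)) t (ns_star tl tr vee p q) =
  Theta *: eval_ext (fun z => subst2 s (br a z)) t (br (R p) q) +
  Theta *: eval_ext (fun z => subst2 s (br a z)) t (br p (R q)) +
  Theta *: (Theta *: eval_ext (fun z => subst2 s (br a z)) t (br p q)).
Proof.
have fK := subst2_linr s a (hl_sesq brH).
apply: etrans (eval_subst2_scale (br a) s t theta _) _.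
rewrite (eval_ext_starE t p q fK).
by rewrite !scalerDr.
Qed.

Lemma vee_star_l s t a p q :
  eval_ext (fun z => subst2 s (vee z a)) t (ns_star tl tr vee p q) =
  Theta *: eval_ext (fun z => subst2 s (br z a)) t (br (R p) q) +
  Theta *: eval_ext (fun z => subst2 s (br z a)) t (br p (R q)) +
  Theta *: (Theta *: eval_ext (fun z => subst2 s (br z a)) t (br p q)).
Proof.
have fK := subst2_linl s a (hl_sesq brH).
apply: etrans (eval_subst2_scale (br^~ a) s t theta _) _.
rewrite (eval_ext_starE t p q fK).
by rewrite !scalerDr.
Qed.

Lemma Rota_Baxter_NS : hom_NS_Leibniz_conformal tl tr vee alpha.
Proof.
have S := hl_sesq brH; have aR := rb_alpha RB.
have Sl : conformal_sesquilinear tl by apply: sesq_compl.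
have Sr : conformal_sesquilinear tr by apply: sesq_compr.
have Sv : conformal_sesquilinear vee by apply: sesq_scale.
have Ss : conformal_sesquilinear (ns_star tl tr vee).
  by apply: sesq_add => //; apply: sesq_add.
have [KL KM] := (ext2_scalar_lam, ext2_scalar_mu).
have Kl s a := subst2_linl s a S; have Kr s a := subst2_linr s a S.
split=> //.
- exact: hl_linear brH.
- exact: hl_d brH.
- by move=> p q; rewrite /tl (hl_mult brH) aR.
- by move=> p q; rewrite /tr (hl_mult brH) aR.
- move=> p q; rewrite /vee map_polymod_scale ?(hl_mult brH) //.
  exact: hl_linear brH.
- move=> p q r; rewrite !prod_at_right ?prod_at_left //.
  by rewrite [LHS](eval_ext_star _ _ _ (Kr _ _)) hl_jacobi_eval /tl !aR.
- move=> p q r; rewrite !prod_at_right ?prod_at_left //.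
  rewrite [X in _ = _ + X](eval_ext_star _ _ _ (Kr _ _)).
  by rewrite /tl /tr -!aR; apply: hl_jacobi_eval.
- move=> p q r; rewrite !prod_at_right ?prod_at_left //.
  rewrite [X in _ = X + _](eval_ext_star _ _ _ (Kl _ _)).
  by rewrite /tl /tr -!aR; apply: hl_jacobi_eval.
- move=> p q r; rewrite !prod_at_right ?prod_at_left //.
  rewrite /tl /tr -!aR; apply: NS_cancel.
  (* The last four goals are the Jacobi identities at (p, R q, r), (p, q, R r),
     (p, q, r) and (R p, q, r), scaled by theta, the third one twice. *)
  - exact: vee_star_r.
  - exact: vee_star_r.
  - exact: vee_star_l.
  - exact: eval_extZ.
  - exact: eval_extZ.
  - exact: eval_extZ.
  - by rewrite hl_jacobi_eval scalerDr.
  - by rewrite hl_jacobi_eval scalerDr.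
  - by rewrite hl_jacobi_eval !scalerDr.
  - by rewrite hl_jacobi_eval scalerDr.
Qed.

End RotaBaxter.
End HomLeibniz.

Theorem proposition5p5 (F : realType) (L : lmodType {poly F[i]})
    (br : L -> L -> polymod L) (alpha : L -> L)
    (theta : F[i]) (R : {linear L -> L}) :
  hom_Leibniz_conformal br alpha ->
  Rota_Baxter theta br alpha R ->
  hom_NS_Leibniz_conformal
    (fun p q => br (R p) q)
    (fun p q => br p (R q))
    (fun p q => theta%:P%:P *: br p q)
    alpha.
Proof. exact: Rota_Baxter_NS. Qed.
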